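(* Let $m,n$ be relatively prime positive integers and let $\Delta(t) \in \mathbb{Z}[t]$ be a primitive polynomial. Then $\Delta(t)$ has the $mn$-Hartley condition if and only if it has both the $m$-Hartley condition and the $n$-Hartley condition.
   Context: Let $\zeta_n = \exp(2\pi i/n)$. A polynomial $\Delta(t) \in \mathbb{Z}[t]$ has the $n$-Hartley condition if there exists $g(t) \in \mathbb{Z}[t]$ with $\Delta(t^n) = \pm \prod_{j=0}^{n-1} g(\zeta_n^j t)$. A polynomial in $\mathbb{Z}[t]$ is primitive if no prime divides all its coefficients. *)

(* Defs.v *)
From HB Require Import structures.
From mathcomp Require Import all_boot all_order all_algebra all_field.
Set Implicit Arguments. Unset Strict Implicit. Unset Printing Implicit Defensive.
Import Order.TTheory GRing.Theory Num.Theory.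
Local Open Scope ring_scope.

(* zeta n = exp(2 pi i / n) in the algebraic complex numbers algC:
   n.-root (-1) is the n-th root of -1 of minimal nonnegative argument,
   i.e. exp(i pi / n) (for n > 0); its square is exp(2 pi i / n). *)
Definition zeta (n : nat) : algC := (n.-root (-1)) ^+ 2.

Definition polyZC (p : {poly int}) : {poly algC} := map_poly intr p.

Definition hartley (n : nat) (Delta : {poly int}) : Prop :=
  exists g : {poly int}, exists s : bool,
    polyZC Delta \Po 'X^n =
      (-1) ^+ s * \prod_(j < n) (polyZC g \Po ((zeta n) ^+ j *: 'X)).

Definition primitive_zpoly (Delta : {poly int}) : Prop :=
  forall p : nat, prime p -> ~ (forall i : nat, (p%:Z %| Delta`_i)%Z).

(* Main.v *)
(* Up to sign, the product of the g(zeta_n^j t) is lead(g)^n times the product of the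
   t^n - a^n, a ranging over the roots of g with multiplicity. So for a primitive Delta
   the n-Hartley condition says that the multiset D of roots of Delta is the multiset of
   n-th powers of a Galois-stable multiset (the leading coefficients then agree up to
   sign by a Gauss lemma argument), and mn-Hartley implies m- and n-Hartley.

   Conversely, for a root b of Delta consider the degrees over K = Q(b) of the n-th roots
   of b. The smallest one, d_n, divides n and divides all the others. Hence D is a
   multiset of n-th powers of a Galois-stable multiset iff d_n divides the multiplicity
   of b in D for every b. For coprime m and n one has d_mn = d_m d_n, since the compositum
   of extensions of coprime degrees d_m and d_n has degree d_m d_n; this also reduces the
   claim on d_n to prime powers n = p^k. If K contains the p-th roots of unity, all
   degrees are powers of p. Otherwise b = g^(p^i) with g in K and i <= k maximal, a root
   of X^(p^(k-i)) - g has degree at most p^(k-i), and taking norms shows that p^(k-i)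
   divides the degree of every p^k-th root of b. *)

Require Import Defs.
From mathcomp Require Import all_boot all_order all_algebra all_field.
From mathcomp Require Import lra ring.
Set Implicit Arguments. Unset Strict Implicit. Unset Printing Implicit Defensive.
Import Order.TTheory GRing.Theory Num.Theory.
Local Open Scope ring_scope.

(** * The root of unity [zeta n] *)

(** Let [(a, b)] and [(c, s)] have angles x in [0, pi] and y in (0, pi). Then [a <= c] means x >= y
    and [b * c <= a * s] means sin(x - y) <= 0; as x - y < pi, the angles agree. *)
Lemma circle_rot_max (R : realDomainType) (a b c s : R) :
  a ^+ 2 + b ^+ 2 = 1 -> c ^+ 2 + s ^+ 2 = 1 -> 0 <= b -> 0 < s ->
  a <= c -> b * c <= a * s -> a = c /\ b = s.
Proof.
move=> h1 h2 b0 s0 ac bcas.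
have hs : b = s.
  have bcs : (s - b) * c >= 0.
    rewrite mulrBl subr_ge0; apply: (le_trans bcas).
    by rewrite mulrC ler_wpM2l // ltW.
  have [lt|lt|//] := ltrgtP b s; exfalso.
    have c0 : 0 <= c by move: bcs; rewrite pmulr_rge0 ?subr_gt0.
    have a0 : 0 <= a by rewrite -(pmulr_lge0 _ s0); apply: le_trans bcas; rewrite mulr_ge0.
    nra.
  have c0 : c <= 0 by move: bcs; rewrite nmulr_rge0 ?subr_lt0.
  have a0 : a <= 0 by apply: le_trans c0.
  nra.
split=> //; apply/le_anti; rewrite ac /= -(ler_pM2r s0).
by rewrite mulrC -{1}hs.
Qed.

Lemma circle_rot_max_algC (a b c s : algC) :
  a \is Num.real -> b \is Num.real -> c \is Num.real -> s \is Num.real ->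
  a ^+ 2 + b ^+ 2 = 1 -> c ^+ 2 + s ^+ 2 = 1 -> 0 <= b -> 0 < s ->
  a <= c -> b * c <= a * s -> a = c /\ b = s.
Proof.
move=> aR bR cR sR h1 h2 b0 s0 ac bcas.
have [] // := @circle_rot_max algR (in_algR aR) (in_algR bR) (in_algR cR) (in_algR sR).
- exact: val_inj.
- exact: val_inj.
by move=> /(congr1 val) /= -> /(congr1 val) /= ->.
Qed.

(* [w := n.-root (-1)] has maximal real part among the n-th roots of -1. If the powers of
   [w ^+ 2] missed some n-th root of unity, then among the roots [y] of -1 outside the
   odd powers of [w] one of maximal real part would come closer to 1 when multiplied by
   [w ^+ 2] or its inverse. *)
Lemma neg_root_prim (n : nat) : (1 < n)%N ->
  n.-primitive_root ((n.-root (-1 : algC)) ^+ 2).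
Proof.
move=> n_gt1; have n_gt0 := ltnW n_gt1.
set w := n.-root _; have wn : w ^+ n = -1 by rewrite rootCK.
have zn : (w ^+ 2) ^+ n = 1 by rewrite exprAC wn sqrrN expr1n.
have w0 : w != 0 by rewrite rootC_eq0 // oppr_eq0 oner_eq0.
have norm1 (y : algC) : y ^+ n = -1 -> 'Re y ^+ 2 + 'Im y ^+ 2 = 1.
  move=> yn; rewrite -normC2_Re_Im; suff -> : `|y| = 1 by rewrite expr1n.
  by apply/eqP; rewrite -(pexpr_eq1 n_gt0) // -normrX yn normrN1.
(* [rootC_Re_max] only compares with roots in the upper half plane; other roots are conjugated,
   which keeps the real part. *)
have Remax (y : algC) : y ^+ n = -1 -> 'Re y <= 'Re w.
  move=> yn; have [Iy|Iy] := real_leP (rpred0 _) (Creal_Im y).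
    exact: rootC_Re_max.
  rewrite -Re_conj; apply: rootC_Re_max => //.
    by rewrite -rmorphXn yn rmorphN1.
  by rewrite Im_conj oppr_ge0 ltW.
have [z zprim] := C_prim_root_exists n_gt0.
pose G u := [exists k : 'I_n, u == (w ^+ 2) ^+ k].
have GM u : G u -> G (u * w ^+ 2).
  move=> /existsP[k /eqP->]; apply/existsP.
  exists (Ordinal (ltn_pmod k.+1 n_gt0)) => /=.
  by rewrite -exprSr expr_mod.
have GX k : G ((w ^+ 2) ^+ k).
  by apply/existsP; exists (Ordinal (ltn_pmod k n_gt0)); rewrite /= expr_mod.
have GV u : G u -> G (u / w ^+ 2).
  move=> /existsP[k /eqP->].
  have -> : (w ^+ 2) ^+ k / w ^+ 2 = (w ^+ 2) ^+ (k + n.-1).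
    apply: (mulIf (expf_neq0 2 w0)); rewrite mulfVK ?expf_neq0 //.
    by rewrite -exprSr -addnS prednK // exprD zn mulr1.
  exact: GX.
have Gz k : G (z ^+ k).
  apply: contraT => nG.
  pose P (i : 'I_n) := ~~ G (z ^+ i).
  have zmod j : z ^+ (j %% n) = z ^+ j by rewrite expr_mod // prim_expr_order.
  pose i0 := Ordinal (ltn_pmod k n_gt0).
  have Pi0 : P i0 by rewrite /P zmod.
  have Freal : {in P, forall i : 'I_n, 'Re (w * z ^+ i) \is Num.real}.
    by move=> i _; apply: Creal_Re.
  case: (real_arg_maxP Pi0 Freal) => i Pi imax.
  set y := w * z ^+ i.
  have yn : y ^+ n = -1.
    by rewrite exprMn wn exprAC (prim_expr_order zprim) expr1n mulr1.
  have unityP (u : algC) : u ^+ n = 1 -> ~~ G u -> 'Re (w * u) <= 'Re y.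
    case/(prim_rootP zprim) => j -> nGj; exact: imax.
  have zin : (z ^+ i) ^+ n = 1 by rewrite exprAC (prim_expr_order zprim) expr1n.
  have r1 : 'Re (y * w ^+ 2) <= 'Re y.
    rewrite -mulrA; apply: unityP; first by rewrite exprMn zin zn mulr1.
    by apply: contra Pi => /GV; rewrite mulfK // expf_neq0.
  have r2 : 'Re (y / w ^+ 2) <= 'Re y.
    rewrite -mulrA; apply: unityP; first by rewrite exprMn exprVn zin zn invr1 mulr1.
    by apply: contra Pi => /GM; rewrite mulfVK // expf_neq0.
  have Iw : 0 <= 'Im w by apply: Im_rootC_ge0.
  have w1 := norm1 _ wn; have y1 := norm1 _ yn.
  have conjw : w^-1 = w^*.
    apply: (mulfI w0); rewrite mulfV // -normCK normC2_Re_Im w1 //.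
  (* A real [w] could only be -1, and by [Remax] it would be the only n-th root of -1; but [w * z]
     is another one, as n > 1. *)
  have Iw0 : 'Im w != 0.
    apply/eqP => Iw0; have Rw : 'Re w = -1.
      move: w1; rewrite Iw0 expr0n addr0 => /eqP; rewrite sqrf_eq1 => /orP[/eqP Rw|/eqP //].
      move: wn; rewrite [w]Crect Rw Iw0 mulr0 addr0 expr1n => /eqP.
      by rewrite -subr_eq0 opprK (pnatr_eq0 algC 2).
    have all1 (u : algC) : u ^+ n = -1 -> u = -1.
      move=> un; have := Remax _ un; rewrite Rw => le1.
      have h := norm1 _ un.
      have Iu0 : 'Im u = 0.
        apply/eqP; rewrite -sqrf_eq0 eq_le real_exprn_even_ge0 ?Creal_Im // andbT.
        have -> : 'Im u ^+ 2 = 1 - 'Re u ^+ 2 by rewrite -h addrC addKr.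
        by rewrite subr_le0 -sqrrN exprn_ege1 // lerNr.
      move: h; rewrite Iu0 expr0n addr0 => /eqP; rewrite sqrf_eq1 => /orP[/eqP Ru|/eqP Ru].
        by move: le1; rewrite Ru (lt_geF (lt_trans (ltrN10 _) ltr01)).
      by rewrite [u]Crect Ru Iu0 mulr0 addr0.
    have wE := all1 _ wn.
    have := all1 (w * z); rewrite exprMn wn (prim_expr_order zprim) mulr1 => /(_ erefl).
    rewrite wE mulN1r => /oppr_inj z1; have := prim_order_dvd zprim 1.
    by rewrite z1 expr1n eqxx dvdn1 => /eqP n1; rewrite n1 in n_gt1.
  have s0 : 0 < 'Im w by rewrite lt_def Iw0 Iw.
  have Ry := Creal_Re y; have Iy := Creal_Im y.
  have c2 : 'Re w ^+ 2 = 1 - 'Im w ^+ 2 by rewrite -w1 addrK.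
  (* On the unit circle, ['Re y - 'Re (y * w ^+ 2)] is [2 * 'Im w] times this sum; [k2] is the
     analogue for the inverse of [w ^+ 2]. *)
  have k1 : 0 <= 'Re y * 'Im w + 'Im y * 'Re w.
    have p2 : 0 < 2 * 'Im w :> algC by rewrite mulr_gt0 ?ltr0n.
    rewrite -(pmulr_rge0 _ p2); move: r1; rewrite -subr_ge0 expr2 !(ReM, ImM).
    by congr (0 <= _); rewrite -!expr2 c2; ring.
  have k2 : 0 <= 'Re y * 'Im w - 'Im y * 'Re w.
    have p2 : 0 < 2 * 'Im w :> algC by rewrite mulr_gt0 ?ltr0n.
    rewrite -(pmulr_rge0 _ p2); move: r2; rewrite -subr_ge0 -exprVn conjw expr2.
    rewrite !(ReM, ImM) !(Re_conj, Im_conj).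
    by congr (0 <= _); rewrite mulrNN -!expr2 c2; ring.
  have yG : y != w /\ y != w^-1.
    split; apply: contra Pi => /eqP yE.
      have -> : z ^+ i = (w ^+ 2) ^+ 0 by apply: (mulfI w0); rewrite mulr1.
      exact: GX.
    have -> : z ^+ i = (w ^+ 2) ^+ 0 / w ^+ 2.
      by apply: (mulfI w0); rewrite -/y yE expr0 mul1r expr2 invfM mulVKf.
    exact/GV/GX.
  case: yG => /eqP yw /eqP yw'.
  (* The circle lemma forces [y = w], or [y = w^-1] if [y] lies in the lower half plane. *)
  have [b0|b0] := real_leP (rpred0 _) Iy.
    have [|e1 e2] := circle_rot_max_algC Ry Iy (Creal_Re w) (Creal_Im w) y1 w1 b0 s0 (Remax _ yn).
      by rewrite -subr_ge0.
    by case: yw; rewrite [y]Crect e1 e2 -Crect.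
  have y1' : 'Re y ^+ 2 + (- 'Im y) ^+ 2 = 1 by rewrite sqrrN.
  have b0' : 0 <= - 'Im y by rewrite oppr_ge0 ltW.
  have [||e1 e2] := circle_rot_max_algC Ry _ (Creal_Re w) (Creal_Im w) y1' w1 b0' s0 (Remax _ yn).
    by rewrite rpredN.
    by rewrite -subr_ge0 mulNr opprK.
  by case: yw'; rewrite conjw [y]Crect e1 -[in 'Im y](opprK ('Im y)) e2 -Im_conj -Re_conj -Crect.
have [d dprim dn] := prim_order_exists n_gt0 zn.
suff -> : n = d by [].
apply/eqP; rewrite eqn_dvd dn andbT (prim_order_dvd zprim).
have /existsP[k /eqP zk] := Gz 1%N.
rewrite expr1 in zk.
by rewrite zk (exprAC (w ^+ 2)) (prim_expr_order dprim) expr1n.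
Qed.

Lemma zeta_prim (n : nat) : (0 < n)%N -> n.-primitive_root (zeta n).
Proof.
case: n => [//|[|n]] _; last exact: neg_root_prim.
rewrite /zeta root1C sqrrN expr1n; apply/andP; split=> //.
by apply/forallP => i; rewrite ord1 unity_rootE expr1n !eqxx.
Qed.

(** * Degrees of n-th roots over a subfield *)

Section FieldRoots.

Variable (F : fieldType).

Lemma exp_root_of_prim n (z x y : F) : n.-primitive_root z -> y != 0 ->
  x ^+ n = y ^+ n -> exists i : 'I_n, x = y * z ^+ i.
Proof.
move=> zprim y0 xy; have [|i xi] := prim_rootP zprim (x := x / y).
  by rewrite exprMn exprVn xy mulfV // expf_neq0.
by exists i; rewrite -xi mulrCA mulfV // mulr1.
Qed.

Lemma prod_XsubC_exp_root n (z a : F) : n.-primitive_root z ->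
  'X^n - (a ^+ n)%:P = \prod_(i < n) ('X - (a * z ^+ i)%:P).
Proof.
move=> zprim; have n_gt0 := prim_order_gt0 zprim.
have [->|a0] := eqVneq a 0.
  rewrite expr0n gtn_eqF // subr0 (eq_bigr (fun=> 'X)) => [|i _].
    by rewrite prodr_const card_ord.
  by rewrite mul0r subr0.
rewrite -(big_map (fun i : 'I_n => a * z ^+ i) xpredT (fun x => 'X - x%:P)).
rewrite (@all_roots_prod_XsubC _ ('X^n - (a ^+ n)%:P)
          [seq a * z ^+ (i : 'I_n) | i <- index_enum 'I_n]).
- by rewrite lead_coefXnsubC // scale1r.
- by rewrite size_XnsubC // size_map -[index_enum _]enumT size_enum_ord.
- apply/allP => _ /mapP[i _ ->].
  by rewrite /root !hornerE exprMn exprAC (prim_expr_order zprim) expr1n mulr1 subrr.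
rewrite uniq_rootsE map_inj_uniq ?index_enum_uniq // => i j /(mulfI a0)/eqP.
by rewrite (eq_prim_root_expr zprim) !modn_small // => /eqP/val_inj.
Qed.

End FieldRoots.

Section RootDegrees.

Variables (F : fieldType) (L : fieldExtType F).
Implicit Types (K : {subfield L}) (a b : L).

Lemma adjoin_degree_dvd K a b :
  a \in <<K; b>>%VS -> (adjoin_degree K a %| adjoin_degree K b)%N.
Proof.
move=> aKb; rewrite -(@dvdn_pmul2r (\dim K)) ?adim_gt0 // -!dim_Fadjoin.
by apply: field_dimS; apply/FadjoinP; split; first exact: subv_adjoin.
Qed.

Lemma adjoin_degreeX K a n : (adjoin_degree K (a ^+ n) %| adjoin_degree K a)%N.
Proof. by apply: adjoin_degree_dvd; rewrite rpredX // memv_adjoin. Qed.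

Lemma adjoin_degree_le_exp K a n :
  (0 < n)%N -> a ^+ n \in K -> (adjoin_degree K a <= n)%N.
Proof.
move=> n_gt0 aK; rewrite -ltnS -size_minPoly.
rewrite -(@size_XnsubC _ n (a ^+ n) n_gt0).
apply: dvdp_leq; first by rewrite -size_poly_gt0 size_XnsubC.
apply: minPoly_dvdp; first by rewrite rpredB ?rpredX ?polyOverX ?polyOverC.
by rewrite /root !hornerE subrr.
Qed.

(* The norm of [a] from K(a) down to K is [v] up to sign. *)
Lemma norm_exp_root K n (z a : L) : n.-primitive_root z -> a != 0 ->
  a ^+ n \in K -> exists2 v, v \in K & v ^+ n = (a ^+ n) ^+ adjoin_degree K a.
Proof.
move=> zprim a0 aK.
have : minPoly K a %| \prod_(i < n) ('X - (a * z ^+ i)%:P).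
  rewrite -prod_XsubC_exp_root //; apply: minPoly_dvdp.
    by rewrite rpredB ?rpredX ?polyOverX ?polyOverC.
  by rewrite /root !hornerE subrr.
case/dvdp_prod_XsubC => m; set s := mask _ _.
rewrite eqp_monic ?monic_minPoly ?monic_prod_XsubC // => /eqP min_eq.
have ss : size s = adjoin_degree K a.
  by have := size_minPoly K a; rewrite min_eq size_prod_XsubC => -[].
exists (\prod_(i <- s) (a * z ^+ i)).
  have: (minPoly K a)`_0 \in K by apply/polyOverP/minPolyOver.
  rewrite min_eq -(big_map (fun i : 'I_n => a * z ^+ i) xpredT (fun x => 'X - x%:P)).
  by rewrite coef0_prod_XsubC big_map rpredMsign.
rewrite -prodrXl (eq_bigr (fun=> a ^+ n)) => [|i _].
  by rewrite big_const_seq count_predT iter_mulr_1 ss.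
by rewrite exprMn exprAC (prim_expr_order zprim) expr1n mulr1.
Qed.

Lemma bezout_exp p r : (0 < r)%N -> coprime r p ->
  exists u v, (u * r = v * p + 1)%N.
Proof.
by move=> r0 co; case: (egcdnP p r0) => u v e _; exists u, v; rewrite e (eqP co).
Qed.

(** With u r = v p + 1 one has x = x^(u r) / x^(v p) = (y^u / x^v)^p. *)
Lemma exp_coprime_root K p r x y : (0 < r)%N -> coprime r p ->
  x \in K -> y \in K -> x != 0 -> x ^+ r = y ^+ p ->
  exists2 w, w \in K & w ^+ p = x.
Proof.
move=> r0 co xK yK x0 xy; have [u [v uv]] := bezout_exp r0 co.
exists (y ^+ u / x ^+ v); first by rewrite rpred_div ?rpredX.
rewrite exprMn exprVn exprAC -xy -!exprM mulnC uv exprD expr1 mulrC mulKf //.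
by rewrite expf_neq0.
Qed.

(* [d] is the smallest degree over K of an n-th root of [b], and all such degrees
   are multiples of it. *)
Definition root_index K n b (d : nat) :=
  [/\ (d %| n)%N, exists2 a, a ^+ n = b & adjoin_degree K a = d
    & forall a, a ^+ n = b -> (d %| adjoin_degree K a)%N].

(** Suitable powers of an mn-th root of [b] are m-th and n-th roots of [b], so its degree is a
    multiple of [d1] and of [d2]. Equality holds for a root in K(a1, a2). *)
Lemma root_indexM K m n b d1 d2 : (0 < m)%N -> b != 0 -> coprime m n ->
  root_index K m b d1 -> root_index K n b d2 -> root_index K (m * n) b (d1 * d2).
Proof.
move=> m0 b0 co [dm [a1 a1b deg1] min1] [dn [a2 a2b deg2] min2].
have cod : coprime d1 d2 by apply: coprime_dvdl dm _; apply: coprime_dvdr dn _.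
have min a : a ^+ (m * n) = b -> (d1 * d2 %| adjoin_degree K a)%N.
  move=> ab; rewrite Gauss_dvd //; apply/andP; split.
    by apply: dvdn_trans (adjoin_degreeX K a n); apply: min1; rewrite -exprM mulnC.
  by apply: dvdn_trans (adjoin_degreeX K a m); apply: min2; rewrite -exprM.
split=> //; first exact: dvdn_mul.
have a10 : a1 != 0.
  by apply: contra b0 => /eqP a10; rewrite -a1b a10 expr0n gtn_eqF.
have [u [v uv]] := bezout_exp m0 co.
(* As [u * m = v * n + 1] and [a1 ^+ m = a2 ^+ n = b], the m-th power of this quotient is b^v a2 /
   b^v = a2. *)
pose a := a2 ^+ u / a1 ^+ v.
have am : a ^+ m = a2.
  rewrite /a exprMn exprVn -!exprM uv [(v * m)%N]mulnC !exprM a1b exprD expr1.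
  by rewrite mulnC exprM a2b mulrC mulKf // expf_neq0.
have ab : a ^+ (m * n) = b by rewrite exprM am.
exists a => //; apply/eqP; rewrite eqn_leq andbC dvdn_leq ?min //=.
rewrite -(@leq_pmul2r (\dim K)) ?adim_gt0 // -dim_Fadjoin.
pose K1 := <<K; a1>>%AS.
apply: (@leq_trans (\dim <<K1; a2>>)).
  apply/dimvS/FadjoinP; split.
    exact: subv_trans (subv_adjoin K a1) (subv_adjoin K1 a2).
  rewrite rpred_div ?rpredX ?memv_adjoin //.
  by apply: subvP (subv_adjoin K1 a2) _ _; apply: memv_adjoin.
rewrite dim_Fadjoin /= dim_Fadjoin deg1 mulnA leq_mul2r; apply/orP; right.
rewrite mulnC leq_mul2l; apply/orP; right.
rewrite -deg2 -ltnS -!size_minPoly; apply: dvdp_leq; first exact/monic_neq0/monic_minPoly.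
by apply: minPolyS; apply: subv_adjoin.
Qed.

Lemma root_index1 K b : b \in K -> root_index K 1 b 1.
Proof.
move=> bK; split=> //; exists b => //.
by apply/eqP; rewrite adjoin_deg_eq1.
Qed.

(** * Roots of prime power exponent over a subfield *)

(** A degree d < p is prime to p. The norm makes (a^p)^d a p-th power in K, so a^p is one too, and
    [a] differs from an element of K by a power of [w]. *)
Lemma adjoin_degree_prime_root K p (w a : L) : prime p -> p.-primitive_root w ->
  w \in K -> a != 0 -> a ^+ p \in K ->
  adjoin_degree K a = 1 \/ adjoin_degree K a = p.
Proof.
move=> pp wprim wK a0 aK; have p0 := prime_gt0 pp.
have := adjoin_degree_le_exp p0 aK; rewrite leq_eqVlt => /predU1P[->|ltp]; first by right.
left; apply/eqP; rewrite adjoin_deg_eq1.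
have [v vK vp] := norm_exp_root wprim a0 aK.
have co : coprime (adjoin_degree K a) p.
  by rewrite coprime_sym prime_coprime // gtnNdvd.
have [||u uK up] := exp_coprime_root _ co aK vK _ (esym vp); rewrite ?expf_neq0 //.
have u0 : u != 0 
  by apply: contraNneq a0 => u0; move/eqP: up; rewrite u0 expr0n gtn_eqF // eq_sym expf_eq0 p0.
have [i ->] := exp_root_of_prim wprim u0 (esym up).
by rewrite rpredM ?rpredX.
Qed.

(** In the tower K, K(a^p), K(a) the upper step has degree 1 or p, and the lower one a power of p by
    induction. *)
Lemma adjoin_degree_prime_power_root K p k (w a : L) :
  prime p -> p.-primitive_root w -> w \in K -> a != 0 -> a ^+ (p ^ k) \in K ->
  exists2 j, (j <= k)%N & adjoin_degree K a = (p ^ j)%N.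
Proof.
move=> pp wprim wK; elim: k a => [|k IH] a a0 aK.
  by exists 0%N => //; apply/eqP; rewrite adjoin_deg_eq1 -[a]expr1.
have [||j jk degj] := IH (a ^+ p); rewrite ?expf_neq0 // -?exprM -?expnS //.
pose K1 := <<K; a ^+ p>>%AS.
have eqa : (<<K1; a>> = <<K; a>>)%VS.
  apply/eqP; rewrite eqEsubv; apply/andP; split; apply/FadjoinP; split.
  - apply/FadjoinP; split; first exact: subv_adjoin.
    by rewrite rpredX // memv_adjoin.
  - exact: memv_adjoin.
  - exact: subv_trans (subv_adjoin K _) (subv_adjoin K1 a).
  - exact: memv_adjoin.
have degM : adjoin_degree K a = (adjoin_degree K1 a * p ^ j)%N.
  apply/eqP; rewrite -(@eqn_pmul2r (\dim K)) ?adim_gt0 // -dim_Fadjoin -eqa.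
  by rewrite dim_Fadjoin /= dim_Fadjoin degj mulnA.
have wK1 : w \in K1 by apply: subvP (subv_adjoin _ _) _ wK.
have [deg1|degp] := adjoin_degree_prime_root pp wprim wK1 a0 (memv_adjoin _ _).
  by exists j; rewrite ?(leqW jk) // degM deg1 mul1n.
by exists j.+1; rewrite // degM degp expnS.
Qed.

Lemma root_index_prime_power_in K p k (z w a : L) :
  prime p -> (p ^ k).-primitive_root z -> p.-primitive_root w -> w \in K ->
  a != 0 -> a ^+ (p ^ k) \in K -> exists d, root_index K (p ^ k) (a ^+ (p ^ k)) d.
Proof.
move=> pp zprim wprim wK a0 aK; have N0 := prim_order_gt0 zprim.
pose i0 := Ordinal N0.
case: (@arg_minnP _ i0 xpredT (fun i : 'I__ => adjoin_degree K (a * z ^+ i))) => // i _ imin.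
have powb (j : nat) : (a * z ^+ j) ^+ (p ^ k) = a ^+ (p ^ k).
  by rewrite exprMn exprAC (prim_expr_order zprim) expr1n mulr1.
have z0 : z != 0 by rewrite (prim_root_eq0 zprim) -lt0n.
have degp (j : nat) : exists2 l, (l <= k)%N & adjoin_degree K (a * z ^+ j) = (p ^ l)%N.
  by apply: adjoin_degree_prime_power_root wprim _ _ _; rewrite ?powb ?mulf_neq0 ?expf_neq0.
have [l lk degl] := degp i; exists (p ^ l)%N; split; first exact: dvdn_exp2l.
  by exists (a * z ^+ i).
move=> a' a'b; have [j ->] := exp_root_of_prim zprim a0 a'b.
have [l' _ degl'] := degp j.
have := imin j isT; rewrite degl degl' leq_exp2l ?prime_gt1 //.
exact: dvdn_exp2l.
Qed.

(** A nontrivial [x] would have a power of exact order p, which generates [w]. So taking p^i-th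
    powers is injective on K when [w] is not in K. *)
Lemma prime_power_unity_notin K p i (w x : L) : prime p -> p.-primitive_root w ->
  w \notin K -> x \in K -> x ^+ (p ^ i) = 1 -> x = 1.
Proof.
move=> pp wprim wK; elim: i x => [|i IH] x xK x1; first by rewrite -[x]expr1.
apply: IH => //; set y := x ^+ _.
have yK : y \in K by rewrite rpredX.
have yp : y ^+ p = 1 by rewrite -exprM -expnSr.
apply/eqP; apply: contraR wK => y1.
have [d dprim dp] := prim_order_exists (prime_gt0 pp) yp.
have dE : d = p.
  case/primeP: pp => _ /(_ d dp) /orP[/eqP d1|/eqP //].
  by move: (prim_order_dvd dprim 1); rewrite d1 dvdn1 expr1 (negPf y1).
rewrite dE in dprim; have [j ->] := prim_rootP dprim (prim_expr_order wprim).
exact: rpredX.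
Qed.

Lemma exp_root_prime_power p k i (z a y : L) : (p ^ k).-primitive_root z ->
  (i <= k)%N -> a != 0 -> y ^+ (p ^ i) = a ^+ (p ^ k) ->
  exists j : 'I_(p ^ k), y = (a * z ^+ j) ^+ (p ^ (k - i)).
Proof.
move=> zprim ik a0 ya; have N0 := prim_order_gt0 zprim.
have kiD : (p ^ k = p ^ i * p ^ (k - i))%N by rewrite -expnD subnKC.
have prim' : (p ^ i).-primitive_root (z ^+ (p ^ (k - i))).
  have -> : (p ^ (k - i) = p ^ k %/ p ^ i)%N.
    by rewrite kiD mulKn //; move: N0; rewrite kiD muln_gt0 => /andP[].
  by apply: dvdn_prim_root => //; rewrite kiD dvdn_mulr.
have [||j ->] := exp_root_of_prim prim' (y := a ^+ (p ^ (k - i))) (x := y).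
- by rewrite expf_neq0.
- by rewrite -exprM mulnC -kiD.
have jlt : (j < p ^ k)%N.
  apply: leq_trans (ltn_ord j) _; rewrite kiD leq_pmulr //.
  by move: N0; rewrite kiD muln_gt0 => /andP[].
by exists (Ordinal jlt); rewrite exprMn -!exprM mulnC.
Qed.

Lemma root_index_prime_power_notin K p k (z w a : L) :
  prime p -> (p ^ k).-primitive_root z -> p.-primitive_root w -> w \notin K ->
  a != 0 -> a ^+ (p ^ k) \in K -> exists d, root_index K (p ^ k) (a ^+ (p ^ k)) d.
Proof.
move=> pp zprim wprim wK a0 aK; have N0 := prim_order_gt0 zprim.
set b := a ^+ (p ^ k) in aK *.
(* By [exp_root_prime_power], [P i] says that [b] is a p^i-th power in K; the finite range of [j]
   makes this decidable. *)
pose P i := (i <= k)%N && [exists j : 'I_(p ^ k), (a * z ^+ j) ^+ (p ^ (k - i)) \in K].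
have P0 : P 0%N.
  by apply/andP; split=> //; apply/existsP; exists (Ordinal N0); rewrite subn0 mulr1.
have Ple i : P i -> (i <= k)%N by case/andP.
case: (@ex_maxnP P k (ex_intro (fun i => P i) 0%N P0) Ple) => i /andP[ik /existsP[j gK]] imax.
have powb (l : nat) : (a * z ^+ l) ^+ (p ^ k) = b.
  by rewrite exprMn exprAC (prim_expr_order zprim) expr1n mulr1.
have kiD : (p ^ k = p ^ (k - i) * p ^ i)%N by rewrite -expnD subnK.
set g := _ ^+ _ in gK.
have gb : g ^+ (p ^ i) = b by rewrite -exprM -kiD powb.
have b0 : b != 0 by rewrite expf_neq0.
have g0 : g != 0.
  by apply: contraNneq b0 => g0; rewrite -gb g0 expr0n gtn_eqF // expn_gt0 prime_gt0.
have min a' : a' ^+ (p ^ k) = b -> (p ^ (k - i) %| adjoin_degree K a')%N.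
  move=> a'b; set d := adjoin_degree K a'.
  have a'0 : a' != 0.
    by apply: contra b0 => /eqP a'0; rewrite -a'b a'0 expr0n gtn_eqF.
  have [|v vK vb] := norm_exp_root zprim a'0 (K := K); first by rewrite a'b.
  rewrite a'b -/d in vb.
  have v0 : v != 0.
    by apply/eqP => v0; move/eqP: vb; rewrite v0 expr0n gtn_eqF // eq_sym expf_eq0 (negPf b0) andbF.
  have d0 : (0 < d)%N by [].
  have unity1 x y l : x \in K -> y \in K -> y != 0 -> x ^+ (p ^ l) = y ^+ (p ^ l) -> x = y.
    move=> xK yK y0 xy; apply: (mulIf (invr_neq0 y0)); rewrite mulfV //.
    apply: (prime_power_unity_notin (i := l) pp wprim wK); first exact: rpred_div.
    by rewrite exprMn exprVn xy mulfV // expf_neq0.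
  (* Suppose d = r p^s with r prime to p and s < k - i. The p^(i+s)-th powers of g^r and
     v^(p^(k-i-s)) agree, hence so do these elements of K. Thus g^r, and with it [g], is a p-th
     power in K, against the maximality of [i]. *)
  rewrite pfactor_dvdn // leqNgt; apply/negP; set s := logn p d => sk.
  pose r := (d %/ p ^ s)%N.
  have dE : d = (r * p ^ s)%N by rewrite /r divnK // pfactor_dvdnn.
  have r0 : (0 < r)%N by move: d0; rewrite dE muln_gt0 => /andP[].
  have co : coprime r p.
    rewrite coprime_sym prime_coprime //; apply/negP => pr.
    by have := pfactor_dvdn s.+1 pp d0; rewrite -/s ltnn dE expnS dvdn_mul.
  pose y := v ^+ (p ^ (k - i - s).-1).
  have yK : y \in K by rewrite rpredX.
  have y0 : y != 0 by rewrite expf_neq0.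
  have gr : g ^+ r = y ^+ p.
    apply: (unity1 _ _ (i + s)%N); [exact: rpredX|exact: rpredX|exact: expf_neq0|].
    rewrite -(exprM g) expnD mulnCA -dE (exprM g) gb -vb /y -!exprM; congr (_ ^+ _).
    rewrite mulnA -expnSr prednK ?subn_gt0 // -!expnD -subnDA subnK //.
    by rewrite -leq_subRL // ltnW.
  have [e eK ep] := exp_coprime_root r0 co gK yK g0 gr.
  have iSk : (i < k)%N by rewrite -subn_gt0 (leq_ltn_trans _ sk).
  have eb : e ^+ (p ^ i.+1) = a ^+ (p ^ k) by rewrite expnS exprM ep gb.
  have [l el] := exp_root_prime_power zprim iSk a0 eb.
  have /imax : P i.+1 by apply/andP; split=> //; apply/existsP; exists l; rewrite -el.
  by rewrite ltnn.
exists (p ^ (k - i))%N; split=> //; first by rewrite dvdn_exp2l // leq_subr.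
exists (a * z ^+ j); first exact: powb.
apply/eqP; rewrite eqn_leq adjoin_degree_le_exp ?expn_gt0 ?prime_gt0 //=.
by rewrite dvdn_leq // min.
Qed.

(** Strong induction on [n]: the full p-part of [n] for a prime divisor p is split off, and
    [root_indexM] combines the two factors. *)
Lemma root_index_exists K n (z a : L) : n.-primitive_root z ->
  a != 0 -> a ^+ n \in K -> exists d, root_index K n (a ^+ n) d.
Proof.
have [b def_b] : exists b, a ^+ n = b by exists (a ^+ n).
elim/ltn_ind: n z a def_b => n IH z a def_b zprim a0; rewrite def_b => bK.
have n0 := prim_order_gt0 zprim.
have [n1|n1] := leqP n 1.
  have -> : n = 1%N by apply/eqP; rewrite eqn_leq n1.
  by exists 1%N; apply: root_index1.
pose p := pdiv n; have pp : prime p by apply: pdiv_prime.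
have := pfactor_coprime pp n0; set k := logn p n; case=> m co nE.
have k0 : (0 < k)%N by rewrite logn_gt0 pi_pdiv.
have m0 : (0 < m)%N by move: n0; rewrite nE muln_gt0 => /andP[].
have b0 : b != 0 by rewrite -def_b expf_neq0.
have primm : m.-primitive_root (z ^+ (p ^ k)).
  have -> : (p ^ k = n %/ m)%N by rewrite nE mulKn.
  by apply: dvdn_prim_root; rewrite // nE dvdn_mulr.
have primk : (p ^ k).-primitive_root (z ^+ m).
  have -> : (m = n %/ p ^ k)%N by rewrite nE mulnK // expn_gt0 prime_gt0.
  by apply: dvdn_prim_root; rewrite // nE dvdn_mull.
have primp : p.-primitive_root (z ^+ (n %/ p)).
  by apply: dvdn_prim_root; rewrite // pdiv_dvd.
have am : (a ^+ (p ^ k)) ^+ m = b by rewrite -exprM mulnC -nE.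
have ak : (a ^+ m) ^+ (p ^ k) = b by rewrite -exprM -nE.
have [|||d1 ind1] := IH m _ _ _ am primm; rewrite ?expf_neq0 ?am //.
  by rewrite nE ltn_Pmulr // -(exp1n k) ltn_exp2r ?prime_gt1.
have [d2 ind2] : exists d, root_index K (p ^ k) b d.
  rewrite -ak; case: (boolP (z ^+ (n %/ p) \in K)) => wK.
    by apply: root_index_prime_power_in primk primp wK _ _; rewrite ?expf_neq0 ?ak.
  by apply: root_index_prime_power_notin primk primp wK _ _; rewrite ?expf_neq0 ?ak.
exists (d1 * d2)%N; rewrite nE; rewrite am in ind1; apply: root_indexM => //.
by rewrite coprimeXr // coprime_sym.
Qed.

End RootDegrees.

(** * Galois-stable multisets of algebraic numbers *)

Lemma poly_ext_horner (R : numDomainType) (p q : {poly R}) :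
  (forall x, p.[x] = q.[x]) -> p = q.
Proof.
move=> pq; apply/eqP; rewrite -subr_eq0; apply: contraT => pq0.
have := @max_poly_roots _ (p - q) [seq i%:R | i <- iota 0 (size (p - q))] pq0.
rewrite size_map size_iota ltnn; apply.
  by apply/allP => _ /mapP[i _ ->]; rewrite /root hornerD hornerN pq subrr.
by rewrite map_inj_uniq ?iota_uniq // => i j /eqP; rewrite eqr_nat => /eqP.
Qed.

(** Both sides are multiplicative in [q], which splits into linear factors; for X - r the
    determinant of M - r is, up to sign, the characteristic polynomial at r. *)
Lemma det_horner_mx (n : nat) (M : 'M[algC]_n.+1) (A : seq algC) (q : {poly algC}) :
  char_poly M = \prod_(a <- A) ('X - a%:P) -> \det (horner_mx M q) = \prod_(a <- A) q.[a].
Proof.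
move=> MA; have sA : size A = n.+1.
  by have := size_char_poly M; rewrite MA size_prod_XsubC => -[].
have [rs ->] := closed_field_poly_normal q; set l := lead_coef q.
rewrite linearZ /= detZ [RHS](eq_bigr (fun a => l * (\prod_(r <- rs) ('X - r%:P)).[a])) => [|a _].
  rewrite big_split /= big_const_seq count_predT iter_mulr_1 sA; congr (_ * _).
  rewrite rmorph_prod (big_morph _ (@det_mulmx _ _) (det1 _ _)).
  rewrite [RHS](eq_bigr (fun a => \prod_(r <- rs) (a - r))) => [|a _]; last first.
    by rewrite horner_prod; apply: eq_bigr => r _; rewrite !hornerE.
  rewrite exchange_big /=; apply: eq_bigr => r _.
  rewrite rmorphB /= horner_mx_X horner_mx_C.
  have -> : M - r%:M = (-1) *: map_mx (horner_eval r) (char_poly_mx M).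
    apply/matrixP => i j; rewrite !mxE /horner_eval /= !hornerE hornerMn hornerX.
    by rewrite mulN1r opprB.
  rewrite detZ det_map_mx /= /horner_eval -/(char_poly M) MA horner_prod -sA.
  rewrite -(count_predT A) -iter_mulr_1 -big_const_seq -big_split /=.
  by apply: eq_bigr => a _; rewrite !hornerE mulN1r opprB.
by rewrite hornerZ.
Qed.

(** Galois-stability of a multiset, encoded by rationality of the monic polynomial with these
    roots. *)
Definition ratseq (A : seq algC) : Prop :=
  exists p : {poly rat}, map_poly ratr p = \prod_(a <- A) ('X - a%:P).

Lemma ratseq_perm A B : perm_eq A B -> ratseq A -> ratseq B.
Proof. by move=> AB [p pA]; exists p; rewrite pA (perm_big _ AB). Qed.

Lemma ratseq_cat A B : ratseq A -> ratseq B -> ratseq (A ++ B).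
Proof. by move=> [p pA] [q qB]; exists (p * q); rewrite rmorphM /= pA qB big_cat. Qed.

Lemma ratseq_monic (A : seq algC) (p : {poly rat}) :
  map_poly ratr p = \prod_(a <- A) ('X - a%:P) -> p \is monic.
Proof. by move=> pA; rewrite -(map_monic (@ratr algC)) pA monic_prod_XsubC. Qed.

(* If A lists the eigenvalues of a rational matrix M, then A^n lists those of M^n. *)
Lemma ratseq_exp n A : ratseq A -> ratseq [seq a ^+ n | a <- A].
Proof.
case: A => [|a0 A0] [p pA]; first by exists 1; rewrite rmorph1 big_nil.
set A := a0 :: A0 in pA *; have mon_p := ratseq_monic pA.
pose m := size A0; have [M pM] : exists M : 'M[rat]_m.+1, char_poly M = p.
  have <- : (size p).-1 = m.+1.
    by rewrite -(size_map_poly (@ratr algC)) pA size_prod_XsubC.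
  by exists (companionmx p); apply: companionmxK.
clearbody A.
exists (char_poly (M ^+ n)); apply: poly_ext_horner => v.
pose MC := map_mx (@ratr algC) M.
have MCA : char_poly MC = \prod_(a <- A) ('X - a%:P) by rewrite -map_char_poly pM pA.
(* The characteristic polynomial of M^n takes at [v] the value det(v - M^n), which is det q(M) for q
   = v - X^n. *)
have := det_horner_mx (v%:P - 'X^n) MCA.
rewrite rmorphB rmorphXn /= horner_mx_X horner_mx_C horner_prod big_map.
rewrite [RHS](eq_bigr (fun a => ('X - (a ^+ n)%:P).[v])) => [<-|a _]; last by rewrite !hornerE.
rewrite map_char_poly /= rmorphXn /= -/MC -/(horner_eval v _) -det_map_mx; congr (\det _).
move: (MC ^+ n) => N; apply/matrixP => i j.
by rewrite !mxE /= /horner_eval !hornerE hornerMn hornerX.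
Qed.

(** * Conjugates and degree over Q *)

Definition conjs (a : algC) : seq algC := sval (closed_field_poly_normal (minCpoly a)).

Definition algdeg (a : algC) : nat := size (conjs a).

Lemma minCpoly_conjs a : minCpoly a = \prod_(x <- conjs a) ('X - x%:P).
Proof.
rewrite /conjs; case: closed_field_poly_normal => r /= ->.
by rewrite (monicP (minCpoly_monic a)) scale1r.
Qed.

Lemma size_minCpoly_algdeg a : size (minCpoly a) = (algdeg a).+1.
Proof. by rewrite minCpoly_conjs size_prod_XsubC. Qed.

Lemma conjs_id a : a \in conjs a.
Proof. by rewrite -root_prod_XsubC -minCpoly_conjs root_minCpoly. Qed.

Lemma algdeg_gt0 a : (0 < algdeg a)%N.
Proof. by rewrite /algdeg; move: (conjs_id a); case: (conjs a). Qed.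

Lemma ratseq_conjs a : ratseq (conjs a).
Proof. by have [p [pE _] _] := minCpolyP a; exists p; rewrite -minCpoly_conjs. Qed.

(** Let p and q be the minimal polynomials of [a] and [b]. If [b] is a root of p, then q divides p,
    and [a] is a root of q or of p/q; the degree of p/q is too small, so p divides q. *)
Lemma mem_conjs a b : (b \in conjs a) = (minCpoly b == minCpoly a).
Proof.
apply/idP/eqP => [|ab]; last first.
  by rewrite -root_prod_XsubC -minCpoly_conjs -ab root_minCpoly.
rewrite -root_prod_XsubC -minCpoly_conjs => rab.
have [p [pE mp] minp] := minCpolyP a; have [q [qE mq] minq] := minCpolyP b.
move: rab; rewrite pE minq => qp.
have : root (map_poly ratr (p %/ q * q)) a by rewrite divpK // -pE root_minCpoly.
rewrite rmorphM rootM !minp; case/orP => [/dvdp_leq le|pq]; last first.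
  by rewrite qE; congr map_poly; apply/eqP; rewrite -eqp_monic // /eqp qp pq.
have q1 : (1 < size q)%N by rewrite -(size_map_poly (@ratr algC)) -qE size_minCpoly.
have p0 := monic_neq0 mp; have q0 := monic_neq0 mq.
have d0 : p %/ q != 0 by rewrite dvdp_div_eq0.
have := le d0; rewrite size_divp // leqNgt; case/negP.
rewrite ltn_subrL -subn1 subn_gt0 q1.
by rewrite size_poly_gt0.
Qed.

(** A nonconstant divisor of the minimal polynomial p has a root conjugate to [a], whose minimal
    polynomial is again p; so p is irreducible. It cannot divide its nonzero derivative and is
    coprime to it. *)
Lemma conjs_uniq a : uniq (conjs a).
Proof.
rewrite -separable_prod_XsubC -minCpoly_conjs.
have [p [pE mp] minp] := minCpolyP a.
rewrite pE separable_map unlock.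
have p0 := monic_neq0 mp.
have p1 : (1 < size p)%N by rewrite -(size_map_poly (@ratr algC)) -pE size_minCpoly.
have irr (q : {poly rat}) : q %| p -> (size q <= 1)%N \/ p %| q.
  move=> qp; have [q1|q1] := leqP (size q) 1; first by left.
  right; have [r rq] : exists r, root (map_poly (ratr : rat -> algC) q) r.
    by apply/closed_rootP; rewrite size_map_poly gtn_eqF.
  have rp : r \in conjs a.
    rewrite -root_prod_XsubC -minCpoly_conjs pE.
    by move: qp => /dvdpP[s ->]; rewrite rmorphM rootM rq orbT.
  have [p' [p'E mp'] minp'] := minCpolyP r.
  move: rq; rewrite minp'; suff -> : p' = p by [].
  apply: (map_poly_inj (@ratr algC)); rewrite -p'E -pE.
  by apply/eqP; rewrite -mem_conjs.
have [] := irr _ (dvdp_gcdl p p^`()).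
  by rewrite coprimep_def leq_eqVlt ltnS leqn0 size_poly_eq0 gcdp_eq0 (negPf p0) orbF.
move=> /dvdp_trans/(_ (dvdp_gcdr _ _)) /dvdp_leq le.
have dp0 : p^`() != 0.
  apply/eqP => /(congr1 (fun q : {poly rat} => q`_(size p).-2)) /eqP.
  rewrite coef_deriv coef0 mulrn_eq0 /=.
  have -> : (size p).-2.+1 = (size p).-1 by case: (size p) p1 => [|[]].
  rewrite -lead_coefE.
  by rewrite (monicP mp) oner_eq0.
by have := le dp0; rewrite leqNgt lt_size_deriv.
Qed.

Lemma ratseq_minCpoly A a : ratseq A -> a \in A ->
  exists2 B, ratseq B & perm_eq A (conjs a ++ B).
Proof.
move=> [p pA] aA; have [q [qE mq] minq] := minCpolyP a.
have : root (map_poly ratr p) a by rewrite pA root_prod_XsubC.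
rewrite minq => /dvdpP[r rE].
have pE : map_poly (@ratr algC) p = map_poly ratr r * minCpoly a by rewrite rE rmorphM qE.
have mr : r \is monic by rewrite -(monicMr _ mq) -rE (ratseq_monic pA).
have [B rB] := closed_field_poly_normal (map_poly (@ratr algC) r).
rewrite lead_coef_map (monicP mr) rmorph1 scale1r in rB.
exists B; first by exists r.
by apply: prod_XsubC_eq; rewrite -pA pE rB minCpoly_conjs big_cat mulrC.
Qed.

(** A Galois-stable multiset is a union of classes [conjs a], split off one at a time. *)
Lemma ratseq_ind (P : seq algC -> Prop) : P [::] ->
  (forall a A B, ratseq A -> P A -> perm_eq B (conjs a ++ A) -> P B) ->
  forall A, ratseq A -> P A.
Proof.
move=> P0 PS A; have [n] := ubnP (size A); elim: n A => // n IH [|a A] // + rA.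
rewrite ltnS => An; have [B rB AB] := ratseq_minCpoly rA (mem_head a A).
apply: (PS _ _ _ rB _ AB); apply: IH => //; apply: leq_trans An.
by rewrite (perm_size AB) size_cat -[X in (X < _)%N]add0n ltn_add2r algdeg_gt0.
Qed.

Lemma mem_conjs_trans a b c : b \in conjs a -> (b \in conjs c) = (a \in conjs c).
Proof. by rewrite !mem_conjs => /eqP->. Qed.

Lemma count_conjs A a b : ratseq A -> b \in conjs a -> count_mem b A = count_mem a A.
Proof.
move=> rA ba; elim/ratseq_ind: A / rA => // c A B _ IH /permP BE.
by rewrite !BE !count_cat IH !(count_uniq_mem _ (conjs_uniq c)) (mem_conjs_trans _ ba).
Qed.

Lemma algdeg_conjs a b : b \in conjs a -> algdeg b = algdeg a.
Proof.
rewrite mem_conjs => /eqP ba; apply: succn_inj.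
by rewrite -!size_minCpoly_algdeg ba.
Qed.

Lemma conjs_sym a b : (a \in conjs b) = (b \in conjs a).
Proof. by rewrite !mem_conjs eq_sym. Qed.

Lemma perm_conjs a b : b \in conjs a -> perm_eq (conjs b) (conjs a).
Proof. by rewrite mem_conjs => /eqP ba; apply: prod_XsubC_eq; rewrite -!minCpoly_conjs ba. Qed.

Lemma ratseq_all_conjs A b : ratseq A -> {subset A <= conjs b} ->
  (count_mem b A * algdeg b)%N = size A.
Proof.
move=> rA; elim/ratseq_ind: A / rA => // c A B _ IH BE sub.
have cb : c \in conjs b by apply: sub; rewrite (perm_mem BE) mem_cat conjs_id.
have bc : b \in conjs c by rewrite conjs_sym.
rewrite (permP BE) (perm_size BE) count_cat size_cat (count_uniq_mem _ (conjs_uniq c)) bc.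
rewrite mulnDl mul1n IH -/(algdeg c) ?(algdeg_conjs bc) // => x xA.
by apply: sub; rewrite (perm_mem BE) mem_cat xA orbT.
Qed.

Lemma exp_mem_conjs n a x : x \in conjs a -> x ^+ n \in conjs (a ^+ n).
Proof.
move=> xa; have [p [pE _] minp] := minCpolyP a; have [q [qE _] minq] := minCpolyP (a ^+ n).
have : root (map_poly ratr (q \Po 'X^n)) a.
  rewrite map_comp_poly rmorphXn /= map_polyX -qE /root horner_comp hornerXn.
  exact: root_minCpoly.
rewrite minp => /dvdpP[r rE].
have : root (map_poly ratr (q \Po 'X^n)) x.
  by rewrite rE rmorphM /= rootM -pE minCpoly_conjs root_prod_XsubC xa orbT.
rewrite map_comp_poly rmorphXn /= map_polyX -qE /root horner_comp hornerXn.
by rewrite -/(root _ _) minCpoly_conjs root_prod_XsubC.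
Qed.

(** The n-th powers of the conjugates of [a] run equally often through the class of [a ^+ n]; the
    multiplicity is the degree of Q(a) over Q(a^n). *)
Lemma count_conjs_exp n a : (count_mem (a ^+ n) [seq x ^+ n | x <- conjs a] *
  algdeg (a ^+ n))%N = algdeg a.
Proof.
rewrite ratseq_all_conjs ?size_map //; first exact/ratseq_exp/ratseq_conjs.
by move=> _ /mapP[x xa ->]; apply: exp_mem_conjs.
Qed.

(** * Multisets of n-th powers *)

Lemma algdeg_adjoin (L : fieldExtType rat) (QC : {rmorphism L -> algC}) (x : L) :
  algdeg (QC x) = \dim <<1; x>>.
Proof.
rewrite dim_Fadjoin dimv1 muln1; apply: succn_inj.
rewrite -size_minCpoly_algdeg -size_minPoly.
have [p [pE mp] minp] := minCpolyP (QC x).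
have QCalg (q : {poly rat}) :
    map_poly QC (map_poly (in_alg L) q) = map_poly ratr q.
  rewrite -map_poly_comp; apply: eq_map_poly => c /=.
  by rewrite alg_num_field fmorph_rat.
have /polyOver1P[q qE] := minPolyOver 1 x.
apply/eqP; rewrite eqn_leq; apply/andP; split.
  rewrite pE qE !size_map_poly; apply: dvdp_leq.
    rewrite -(map_poly_eq0 (in_alg L)) -qE; exact/monic_neq0/monic_minPoly.
  by rewrite -minp -QCalg -qE fmorph_root root_minPoly.
rewrite pE size_map_poly -(size_map_poly (in_alg L) p); apply: dvdp_leq.
  by rewrite map_poly_eq0 monic_neq0.
apply: minPoly_dvdp; first exact: alg_polyOver.
by rewrite -(fmorph_root QC) QCalg -pE root_minCpoly.
Qed.

Lemma perm_cat_complement (T : eqType) (s t : seq T) :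
  (forall x, count_mem x s <= count_mem x t)%N -> exists u, perm_eq t (s ++ u).
Proof.
elim: s t => [|x s IH] t st; first by exists t.
have xt : x \in t.
  by rewrite -has_pred1 has_count; apply: leq_trans (st x); rewrite /= eqxx.
have [y|u tu] := IH (rem x t).
  have := st y; rewrite (permP (perm_to_rem xt)) /=.
  by rewrite leq_add2l.
by exists u; rewrite (permPl (perm_to_rem xt)) perm_cons.
Qed.

Lemma ratseq_catl A B : ratseq A -> ratseq (A ++ B) -> ratseq B.
Proof.
move=> [p pA] [q qAB]; exists (q %/ p).
by rewrite map_divp qAB pA big_cat /= mulKp // monic_neq0 // monic_prod_XsubC.
Qed.

(* [root_index] over the field Q(b), with degrees taken over Q. *)
Definition alg_root_index (n : nat) (b : algC) (d : nat) :=
  (exists2 a, a ^+ n = b & algdeg a = (d * algdeg b)%N) /\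
  forall a, a ^+ n = b -> (d * algdeg b %| algdeg a)%N.

(** An n-th root y of a^n satisfies Q(y) = K(y) for K = Q(a^n), so degrees over Q and over K differ
    by the factor [K : Q]. As L contains [z] and [a], all complex n-th roots come from L. *)
Lemma root_index_alg (L : fieldExtType rat) (QC : {rmorphism L -> algC}) n (z a : L) d :
  n.-primitive_root z -> a != 0 ->
  root_index <<1; a ^+ n>>%AS n (a ^+ n) d -> alg_root_index n (QC (a ^+ n)) d.
Proof.
move=> zprim a0 [_ [x xb degx] min].
have deg y : y ^+ n = a ^+ n ->
    algdeg (QC y) = (adjoin_degree <<1; a ^+ n>>%AS y * algdeg (QC (a ^+ n)))%N.
  move=> yb; rewrite !algdeg_adjoin -dim_Fadjoin; congr (\dim _).
  apply/eqP; rewrite eqEsubv; apply/andP; split; apply/FadjoinP; split.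
  - by apply: subv_trans (subv_adjoin _ _); apply: subv_adjoin.
  - exact: memv_adjoin.
  - apply/FadjoinP; split; first exact: subv_adjoin.
    by rewrite -yb rpredX // memv_adjoin.
  - exact: memv_adjoin.
split; first by exists (QC x); rewrite -?rmorphXn ?xb // deg // degx.
have zC : n.-primitive_root (QC z) by rewrite fmorph_primitive_root.
move=> y yb; have [||i ->] := exp_root_of_prim zC (y := QC a) (x := y).
- by rewrite fmorph_eq0.
- by rewrite yb rmorphXn.
have yb' : (a * z ^+ i) ^+ n = a ^+ n.
  by rewrite exprMn exprAC (prim_expr_order zprim) expr1n mulr1.
rewrite -rmorphXn -rmorphM /= (deg _ yb'); exact: dvdn_mul (min _ yb') (dvdnn _).
Qed.

Lemma alg_root_index0 n : (0 < n)%N -> alg_root_index n 0 1.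
Proof.
move=> n0; split; first by exists 0; rewrite ?mul1n // expr0n gtn_eqF.
move=> a /eqP; rewrite expf_eq0 n0 => /eqP ->.
by rewrite mul1n.
Qed.

Lemma alg_root_index_coprime m n b : (0 < m)%N -> (0 < n)%N -> coprime m n ->
  exists d1 d2, [/\ coprime d1 d2, alg_root_index m b d1, alg_root_index n b d2
    & alg_root_index (m * n) b (d1 * d2)].
Proof.
move=> m0 n0 co; have N0 : (0 < m * n)%N by rewrite muln_gt0 m0.
have [->|b0] := eqVneq b 0.
  by exists 1%N, 1%N; split=> //; apply: alg_root_index0.
have [z zprim] := C_prim_root_exists N0.
pose a := (m * n).-root b.
(* A number field with one mn-th root of [b] and a primitive mn-th root of unity contains all the
   roots involved. *)
have [L [QC [[|z' [|a' [|]]] // [zE aE] _]]] := num_field_exists [:: z; a].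
have ab : QC (a' ^+ (m * n)) = b by rewrite rmorphXn /= aE rootCK.
have a'0 : a' != 0.
  by rewrite -(fmorph_eq0 QC) aE rootC_eq0.
have zprim' : (m * n).-primitive_root z' by rewrite -(fmorph_primitive_root QC) zE.
pose K := <<1; a' ^+ (m * n)>>%AS.
have bK : a' ^+ (m * n) \in K by apply: memv_adjoin.
have primm : m.-primitive_root (z' ^+ n).
  have -> : (n = (m * n) %/ m)%N by rewrite mulKn.
  by apply: dvdn_prim_root => //; rewrite dvdn_mulr.
have primn : n.-primitive_root (z' ^+ m).
  have -> : (m = (m * n) %/ n)%N by rewrite mulnK.
  by apply: dvdn_prim_root => //; rewrite dvdn_mull.
have am : (a' ^+ n) ^+ m = a' ^+ (m * n) by rewrite -exprM mulnC.
have an : (a' ^+ m) ^+ n = a' ^+ (m * n) by rewrite -exprM.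
have [|d1 ind1] := root_index_exists (K := K) primm (expf_neq0 n a'0); first by rewrite am.
have [|d2 ind2] := root_index_exists (K := K) primn (expf_neq0 m a'0); first by rewrite an.
rewrite am in ind1; rewrite an in ind2.
have ind := root_indexM m0 (expf_neq0 (m * n) a'0) co ind1 ind2.
exists d1, d2; rewrite -ab; split.
- by case: ind1 ind2 => d1m _ _ [d2n _ _]; apply: coprime_dvdl d1m (coprime_dvdr d2n co).
- by rewrite -am; apply: root_index_alg primm (expf_neq0 n a'0) _; rewrite am.
- by rewrite -an; apply: root_index_alg primn (expf_neq0 m a'0) _; rewrite an.
- exact: root_index_alg zprim' a'0 ind.
Qed.

(** A class of A containing an n-th root a' of [b] contributes [b] exactly [algdeg a' / algdeg b]
    times, by [count_conjs_exp]; the other classes contribute nothing. *)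
Lemma alg_root_index_dvd_count n b d A : (0 < n)%N -> ratseq A -> alg_root_index n b d ->
  (d %| count_mem b [seq a ^+ n | a <- A])%N.
Proof.
move=> n0 rA [_ min]; elim/ratseq_ind: A / rA => // a A B rA IH BE.
rewrite (permP (perm_map _ BE)) map_cat count_cat dvdn_addl //.
case: (boolP (b \in [seq x ^+ n | x <- conjs a])) => [|/count_memPn -> //].
case/mapP => a' a'a bE.
have /(perm_map (fun x => x ^+ n))/permP <- := perm_conjs a'a.
have := min a' (esym bE); rewrite -(count_conjs_exp n a') -bE.
by rewrite dvdn_pmul2r // algdeg_gt0.
Qed.

Lemma count_conjs_exp_eq n a x : x \in conjs (a ^+ n) ->
  count_mem x [seq y ^+ n | y <- conjs a] = count_mem (a ^+ n) [seq y ^+ n | y <- conjs a].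
Proof. by move=> xa; apply: count_conjs xa; apply/ratseq_exp/ratseq_conjs. Qed.

(** Greedy removal: if [a] is an n-th root of [b] of smallest degree, the n-th powers of [conjs a]
    form [d] copies of the class of [b]. They fit into D, and the rest inherits the hypotheses. *)
Lemma ratseq_exp_lift n D : (0 < n)%N -> ratseq D ->
  (forall b, b \in D -> exists2 d, alg_root_index n b d & (d %| count_mem b D)%N) ->
  exists2 C, ratseq C & perm_eq [seq c ^+ n | c <- C] D.
Proof.
move=> n0; have [N] := ubnP (size D); elim: N D => // N IH [|b D'] sD rD hyp.
  by exists [::].
set D := b :: D' in sD rD hyp *; have bD : b \in D by apply: mem_head.
have [d [[a ab dega] min] dD] := hyp b bD.
set S := [seq x ^+ n | x <- conjs a].
have d0 : (0 < d)%N by move: (algdeg_gt0 a); rewrite dega muln_gt0 => /andP[].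
have Sb : count_mem b S = d.
  by apply/eqP; rewrite -(eqn_pmul2r (algdeg_gt0 b)) -dega -ab count_conjs_exp.
have Sx x : count_mem x S = if x \in conjs b then d else 0%N.
  case: ifP => [xb|/negP xb].
    by rewrite -Sb -ab; apply: count_conjs_exp_eq; rewrite ab.
  apply/count_memPn/negP => /mapP[y ya xE]; apply: xb.
  by rewrite xE -ab exp_mem_conjs.
have rS : ratseq S by apply/ratseq_exp/ratseq_conjs.
have dle : (d <= count_mem b D)%N by rewrite dvdn_leq //= eqxx.
have [E ED] : exists E, perm_eq D (S ++ E).
  apply: perm_cat_complement => x; rewrite Sx; case: ifP => // xb.
  by rewrite (count_conjs rD xb).
have rE : ratseq E by apply: ratseq_catl rS (ratseq_perm ED rD).
have [|||C' rC' C'E] := IH E => //.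
- rewrite ltnS in sD; apply: leq_trans sD.
  rewrite (perm_size ED) size_cat -[X in (X < _)%N]add0n ltn_add2r.
  by rewrite size_map algdeg_gt0.
(* If [x] is conjugate to [b], then [d] copies of it were removed. Its index [d'] divides [d], as
   [x] has an n-th root in [conjs a], of degree [d * algdeg b]. *)
- move=> x xE; have xD : x \in D by rewrite (perm_mem ED) mem_cat xE orbT.
  have [d' [ex min'] d'D] := hyp x xD; exists d' => //.
  move: d'D; rewrite (permP ED) count_cat Sx; case: ifP => // xb.
  rewrite dvdn_addr //.
  have : x \in S by rewrite -has_pred1 has_count Sx xb.
  case/mapP => y ya xE'; have := min' y (esym xE').
  by rewrite (algdeg_conjs ya) dega (algdeg_conjs xb) dvdn_pmul2r ?algdeg_gt0.
exists (conjs a ++ C'); first by apply: ratseq_cat => //; apply: ratseq_conjs.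
by rewrite map_cat perm_sym (permPl ED) perm_cat2l perm_sym.
Qed.

(** * The Hartley condition in terms of roots *)

(** At v the factors are z^j v - a = -(a - v z^j), and the product of the a - v z^j is a^n - v^n. *)
Lemma prod_twist_XsubC n (z a : algC) : n.-primitive_root z ->
  \prod_(j < n) (('X - a%:P) \Po (z ^+ j *: 'X)) =
  (-1) ^+ n.+1 *: (('X - (a ^+ n)%:P) \Po 'X^n).
Proof.
move=> zprim; apply: poly_ext_horner => v; rewrite horner_prod.
rewrite (eq_bigr (fun j : 'I_n => - ('X - (v * z ^+ j)%:P).[a])) => [|j _]; last first.
  by rewrite horner_comp !hornerE opprB mulrC.
rewrite prodrN card_ord -horner_prod -prod_XsubC_exp_root //.
by rewrite hornerZ horner_comp !hornerE exprS mulN1r mulNr -mulrN opprB.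
Qed.

Lemma prod_twist n (z l : algC) (A : seq algC) : n.-primitive_root z ->
  \prod_(j < n) ((l *: \prod_(a <- A) ('X - a%:P)) \Po (z ^+ j *: 'X)) =
  ((-1) ^+ (n.+1 * size A) * l ^+ n) *:
    ((\prod_(a <- [seq x ^+ n | x <- A]) ('X - a%:P)) \Po 'X^n).
Proof.
move=> zprim; rewrite (eq_bigr (fun j : 'I_n =>
    l *: \prod_(a <- A) (('X - a%:P) \Po (z ^+ j *: 'X)))) => [|j _]; last first.
  by rewrite linearZ /= rmorph_prod.
rewrite scaler_prod prodr_const card_ord exchange_big /=.
rewrite (eq_bigr _ (fun a _ => prod_twist_XsubC a zprim)) scaler_prod.
rewrite big_const_seq count_predT iter_mulr_1 -exprM scalerA mulrC.
by rewrite rmorph_prod /= big_map.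
Qed.

Lemma polyZC_inj : injective polyZC.
Proof. by apply: map_inj_poly => //; apply: intr_inj. Qed.

Lemma lead_coef_polyZC g : lead_coef (polyZC g) = (lead_coef g)%:~R.
Proof. by rewrite lead_coef_map_inj //; apply: intr_inj. Qed.

Lemma polyZC_eq0 g : (polyZC g == 0) = (g == 0).
Proof. by rewrite -(inj_eq polyZC_inj) /polyZC rmorph0. Qed.

Lemma comp_polyXn_inj (R : idomainType) n : (0 < n)%N ->
  injective (fun p : {poly R} => p \Po 'X^n).
Proof.
move=> n0 p q /= /eqP; rewrite -subr_eq0 -rmorphB /= comp_poly_eq0 ?subr_eq0 => [/eqP//|].
by rewrite size_polyXn.
Qed.

Lemma hartley_ratseq n Delta : (0 < n)%N -> Delta != 0 -> hartley n Delta ->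
  exists2 A, ratseq A &
    polyZC Delta = (lead_coef Delta)%:~R *: \prod_(a <- [seq x ^+ n | x <- A]) ('X - a%:P).
Proof.
move=> n0 D0 [g [s gE]]; have zprim := zeta_prim n0.
have [A gA] := closed_field_poly_normal (polyZC g).
rewrite gA (prod_twist _ _ zprim) -(rmorph_sign polyC) mul_polyC scalerA in gE.
move: gE; set c := _ * _ => gE.
have {}gE : polyZC Delta = c *: \prod_(a <- [seq x ^+ n | x <- A]) ('X - a%:P).
  by apply: (comp_polyXn_inj n0); rewrite gE linearZ.
have cE : c = (lead_coef Delta)%:~R.
  by rewrite -lead_coef_polyZC gE lead_coefZ lead_coef_prod_XsubC mulr1.
exists A; last by rewrite -cE.
have l0 : lead_coef g != 0.
  apply: contra D0; rewrite -polyZC_eq0 gE lead_coef_eq0 /c => /eqP ->.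
  by rewrite lead_coef_polyZC lead_coef0 expr0n gtn_eqF // !mulr0 scale0r.
exists ((lead_coef g)%:~R^-1 *: map_poly intr g).
rewrite map_polyZ /= fmorphV rmorph_int -map_poly_comp.
have -> : map_poly (ratr \o intr) g = polyZC g.
  by apply: eq_map_poly => x /=; rewrite rmorph_int.
by rewrite gA lead_coef_polyZC scalerK // intr_eq0.
Qed.

(** * Divisibility in the algebraic integers and the Gauss lemma argument *)

(** The quotient x/p is rational and an algebraic integer, hence an integer. *)
Lemma dvdz_Aint (p x : int) (h : algC) : p != 0 -> h \in Aint ->
  x%:~R = p%:~R * h -> (p %| x)%Z.
Proof.
move=> p0 hA xE; have p0' : (p%:~R : algC) != 0 by rewrite intr_eq0.
have hE : h = x%:~R / p%:~R by rewrite xE mulrAC mulfV // mul1r.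
have hQ : h \in Crat by rewrite hE rpred_div // rpred_int.
have /intrP[k kE] := Cint_rat_Aint hQ hA.
apply/dvdzP; exists k; apply: (@intr_inj algC).
by rewrite xE kE rmorphM mulrC.
Qed.

Lemma prime_dvdzM (p : nat) (x y : int) : prime p ->
  (p%:Z %| x * y)%Z = (p%:Z %| x)%Z || (p%:Z %| y)%Z.
Proof. by move=> pp; rewrite !dvdzE abszM Euclid_dvdM. Qed.

Lemma prime_dvdzX (p n : nat) (x : int) : prime p -> (p%:Z %| x ^+ n)%Z -> (p%:Z %| x)%Z.
Proof. by move=> pp; rewrite !dvdzE abszX Euclid_dvdX // => /andP[]. Qed.

Lemma prod_eq_mod (R : comNzRingType) (S : subringClosed R) (c : R) n (f g : 'I_n -> R) :
  c \in S -> (forall j, g j \in S) ->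
  (forall j, exists2 h, h \in S & f j = g j + c * h) ->
  exists2 h, h \in S & \prod_j f j = \prod_j g j + c * h.
Proof.
move=> cS gS fg.
suff [] : \prod_j g j \in S /\ exists2 h, h \in S & \prod_j f j = \prod_j g j + c * h by [].
pose K x y := y \in S /\ exists2 h, h \in S & x = y + c * h.
apply: (big_rec2 (fun y x => K x y)).
  by split; [exact: rpred1 | exists 0; rewrite ?rpred0 // mulr0 addr0].
move=> j y x _ [yS [h hS xE]]; have [k kS fE] := fg j; split; first exact: rpredM.
exists (g j * h + k * y + c * k * h).
  by rewrite !rpredD // !rpredM.
by rewrite xE fE; ring.
Qed.

Lemma polyOver_Aint_twist n (z : algC) (g : {poly int}) j : n.-primitive_root z ->
  polyZC g \Po (z ^+ j *: 'X) \is a polyOver Aint.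
Proof.
move=> zprim; rewrite polyOver_comp ?polyOverZ ?polyOverX //.
  by apply/polyOverP => i; rewrite coef_map Aint_int.
by apply: rpredX; apply: Aint_prim_root zprim.
Qed.

(* Modulo p, g may be replaced by its truncation g0 after the last coefficient prime
   to p, and the twisted product of g0 has leading coefficient [g`_d ^+ n] up to sign. *)
Lemma prod_twist_coef_mod n (z : algC) (g : {poly int}) (p : nat) : n.-primitive_root z ->
  prime p -> zcontents g = 1 ->
  exists k e s h, [/\ ~~ (p%:Z %| e)%Z, h \in Aint &
   (\prod_(j < n) (polyZC g \Po (z ^+ j *: 'X)))`_k = (-1) ^+ s * e%:~R + p%:R * h].
Proof.
move=> zprim pp gc; have n0 := prim_order_gt0 zprim.
pose P i := ~~ (p%:Z %| g`_i)%Z.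
have [i0 Pi0] : exists i, P i.
  have : ~~ (g \is a polyOver (dvdz p)).
    by rewrite -dvdz_contents gc dvdz1 /= neq_ltn prime_gt1 ?orbT.
  by case/allPn => _ /(nthP 0)[i _ <-] Pi; exists i.
have Ple i : P i -> (i <= size g)%N.
  by apply: contraR; rewrite -ltnNge => /ltnW le; rewrite nth_default ?dvdz0.
have [d Pd dmax] := @ex_maxnP P (size g) (ex_intro (fun i => P i) i0 Pi0) Ple.
pose g0 := take_poly d.+1 g.
have [g1 gE] : exists g1 : {poly int}, g = g0 + p%:Z *: g1.
  exists (map_poly (fun x => (x %/ p)%Z) (g - g0)); apply/polyP => i.
  rewrite coefD coefZ coef_map_id0 ?div0z // coefB coef_take_poly.
  case: ifP => lt_id; first by rewrite subrr div0z mulr0 addr0.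
  rewrite subr0 add0r mulrC divzK //; apply/negPn/negP => Pi.
  by have := dmax _ Pi; rewrite -ltnS lt_id.
have gd0 : g`_d != 0 by apply: contraNneq Pd => ->; apply: dvdz0.
have sg0 : size (polyZC g0) = d.+1.
  rewrite size_map_inj_poly //; last exact: intr_inj.
  apply/eqP; rewrite eqn_leq size_take_poly ltnNge; apply: contra gd0 => le.
  have -> : g`_d = g0`_d by rewrite coef_take_poly ltnSn.
  by rewrite nth_default.
have lg0 : lead_coef (polyZC g0) = (g`_d)%:~R.
  by rewrite lead_coefE sg0 coef_map coef_take_poly ltnSn.
have [A gA] := closed_field_poly_normal (polyZC g0).
have sA : size A = d.
  have := sg0; rewrite gA size_scale ?size_prod_XsubC => [[]//|].
  by rewrite lg0 intr_eq0.
have pA : (p%:R)%:P \is a polyOver Aint by rewrite polyOverC; apply: Aint_int p.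
have [j|h hA hE] := prod_eq_mod (f := fun j : 'I_n => polyZC g \Po (z ^+ j *: 'X)) pA
  (fun j : 'I_n => polyOver_Aint_twist g0 j zprim).
  exists (polyZC g1 \Po (z ^+ j *: 'X)); first exact: (polyOver_Aint_twist _ _ zprim).
  rewrite {1}gE /polyZC rmorphD /= map_polyZ /= comp_polyD comp_polyZ.
  by rewrite -mul_polyC.
(* As [g0] has degree [d], its twisted product has degree [d * n], and the coefficient there is the
   leading one. *)
exists (d * n)%N, (g`_d ^+ n), (n.+1 * size A)%N, h`_(d * n); split.
- by apply: contra Pd; apply: prime_dvdzX.
- exact: (polyOverP hA).
rewrite hE coefD coefCM; congr (_ + _).
rewrite gA (prod_twist _ _ zprim) coefZ coef_comp_poly_Xn // dvdn_mull // mulnK //.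
rewrite lg0 rmorphXn; set B := [seq _ | _ <- A].
have : (\prod_(a <- B) ('X - a%:P))`_d = 1.
  have := lead_coef_prod_XsubC B xpredT id; rewrite lead_coefE size_prod_XsubC.
  by rewrite size_map sA.
by move=> ->; rewrite mulr1.
Qed.

Lemma int_eq_or_opp (x y : int) : `|x|%N = `|y|%N -> exists s : nat, x = (-1) ^+ s * y.
Proof.
move=> xy; have /eqP := congr1 Posz xy; rewrite !abszE eqr_norm2 => /orP[]/eqP->.
  by exists 0%N; rewrite mul1r.
by exists 1%N; rewrite mulN1r.
Qed.

(** Clearing denominators gives a primitive [g] with roots A. Its twisted product [G] is
    proportional to Delta(X^n), and since no prime divides either of them, the factor is a sign. *)
Lemma ratseq_hartley n Delta A : (0 < n)%N -> primitive_zpoly Delta -> ratseq A ->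
  polyZC Delta = (lead_coef Delta)%:~R *: \prod_(a <- [seq x ^+ n | x <- A]) ('X - a%:P) ->
  hartley n Delta.
Proof.
move=> n0 Dprim [p pA] DE; have zprim := zeta_prim n0.
have D0 : Delta != 0.
  apply/eqP => D0; apply: (Dprim 2) => // i; rewrite D0 coef0; exact: dvdz0.
have [q [a a0 pE]] := rat_poly_scale p.
have p0 : p != 0 by apply: monic_neq0 (ratseq_monic pA).
have q0 : q != 0 by apply: contraNneq p0 => q0; rewrite pE q0 map_poly0 scaler0.
pose g := zprimitive q; have gc : zcontents g = 1 by rewrite zcontents_primitive q0.
have g0 : g != 0 by rewrite zprimitive_eq0.
have gA : polyZC g = (lead_coef g)%:~R *: \prod_(a <- A) ('X - a%:P).
  have [c cE] : exists c : algC, polyZC g = c *: \prod_(a <- A) ('X - a%:P).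
    have qE : polyZC q = a%:~R *: \prod_(a <- A) ('X - a%:P).
      rewrite -pA pE map_polyZ /= fmorphV rmorph_int -map_poly_comp.
      rewrite scalerA mulfV ?intr_eq0 // scale1r.
      by apply: eq_map_poly => x /=; rewrite rmorph_int.
    exists ((zcontents q)%:~R^-1 * a%:~R); rewrite -scalerA -qE.
    by rewrite {2}[q]zpolyEprim /polyZC map_polyZ /= scalerK // intr_eq0 zcontents_eq0.
  by rewrite -lead_coef_polyZC cE lead_coefZ lead_coef_prod_XsubC mulr1.
set l := lead_coef g in gA; have l0 : l != 0 by rewrite lead_coef_eq0.
set e := lead_coef Delta in DE; have e0 : e != 0 by rewrite lead_coef_eq0.
pose G := \prod_(j < n) (polyZC g \Po (zeta n ^+ j *: 'X)).
pose S := \prod_(a <- [seq x ^+ n | x <- A]) ('X - a%:P).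
have GE : G = ((-1) ^+ (n.+1 * size A) * l%:~R ^+ n) *: (S \Po 'X^n).
  by rewrite /G gA prod_twist.
set eps := (-1) ^+ _ in GE.
have eps2 : eps * eps = 1 by rewrite -expr2 sqrr_sign.
have GD : e%:~R *: G = (eps * (l ^+ n)%:~R) *: (polyZC Delta \Po 'X^n).
  by rewrite GE DE comp_polyZ !scalerA rmorphXn mulrC.
have GA k : G`_k \in Aint.
  suff /polyOverP : G \is a polyOver Aint by apply.
  apply: rpred_prod => j _.
  exact: (polyOver_Aint_twist _ _ zprim).
have DnP (r : nat) (x : int) : prime r -> (forall k, (r%:Z %| x * Delta`_k)%Z) -> (r%:Z %| x)%Z.
  move=> rp rx; apply: contraT => nrx; case: (Dprim r rp) => i.
  by have := rx i; rewrite prime_dvdzM // (negPf nrx).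
have epsA : eps \in Aint by rewrite rpredX // rpredN1.
(* Cancelling this gcd turns [GD] into e' G = eps l' Delta(X^n) with e' and l' coprime; both will
   turn out to be units. *)
pose d := gcdz e (l ^+ n).
have d0 : d != 0 by rewrite gcdz_eq0 negb_and e0.
have [e' eE] := dvdzP (dvdz_gcdl e (l ^+ n)); have [l' lE] := dvdzP (dvdz_gcdr e (l ^+ n)).
rewrite -/d in eE lE.
have co : coprimez e' l'.
  have dabs : `|d|%N = d :> int by [].
  by apply/eqP/(mulIf d0); rewrite mul1r -{1}dabs mulz_gcdl -eE -lE.
have GDk : forall i, e'%:~R * G`_i = eps * l'%:~R * (polyZC Delta \Po 'X^n)`_i.
  move=> i; have := congr1 (fun u : {poly algC} => u`_i) GD.
  rewrite !coefZ {1}eE lE !rmorphM /= => h.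
  have dC : (d%:~R : algC) != 0 by rewrite intr_eq0.
  by apply: (mulfI dC); rewrite mulrA [d%:~R * _]mulrC h; ring.
have nprime (x y : int) (r : nat) : prime r -> coprimez x y ->
    (r%:Z %| x)%Z -> (r%:Z %| y)%Z -> False.
  move=> rp xy rx ry; have : (r%:Z %| gcdz x y)%Z by rewrite dvdz_gcd rx.
  by rewrite (eqP xy) dvdz1 /= gtn_eqF // prime_gt1.
have absz_eq1 (x : int) : x != 0 ->
    (forall r : nat, prime r -> ~~ (r%:Z %| x)%Z) -> `|x|%N = 1%N.
  move=> x0 nr; apply/eqP; apply: contraT; rewrite neq_ltn ltnS leqn0 absz_eq0 (negPf x0) /=.
  by move/pdiv_prime/nr; rewrite dvdzE /= pdiv_dvd.
(* A prime dividing [e'] divides [l'] times every coefficient of [Delta], as [G] has algebraic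
   integer coefficients; by primitivity it divides [l']. *)
have e1 : `|e'|%N = 1%N.
  apply: absz_eq1 => [|r rp]; first by apply: contraNneq e0 => e'0; rewrite eE e'0 mul0r.
  apply/negP => re; apply: (nprime _ _ _ rp co re); apply: DnP => // i.
  case/dvdzP: re => c cE.
  apply: (@dvdz_Aint _ _ (eps * c%:~R * G`_(i * n))).
  - by rewrite eqz_nat -lt0n prime_gt0.
  - by apply: rpredM (GA _); apply: rpredM epsA (Aint_int _).
  have := GDk (i * n)%N; rewrite coef_comp_poly_Xn // dvdn_mull // mulnK //.
  rewrite coef_map cE !rmorphM => h.
  transitivity (eps * (eps * l'%:~R * (Delta`_i)%:~R)); first by rewrite !mulrA eps2 mul1r.
  by rewrite -h; ring.
(* Modulo a prime [r] dividing [l'], some coefficient of [G] is up to sign an integer [E] prime to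
   [r]; as [r] divides [e' * E], it divides [e']. *)
have l1 : `|l'|%N = 1%N.
  apply: absz_eq1 => [|r rp].
    by apply: contraNneq l0 => l'0; move/eqP: lE; rewrite l'0 mul0r expf_eq0 n0.
  apply/negP => rl; have [i [E [s [h [rE hA hE]]]]] := prod_twist_coef_mod zprim rp gc.
  have : (r%:Z %| e' * E)%Z.
    case/dvdzP: rl => c cE; rewrite -/G in hE.
    pose w := (polyZC Delta \Po 'X^n)`_i.
    apply: (@dvdz_Aint _ _ ((-1) ^+ s * (eps * c%:~R * w - e'%:~R * h))).
    - by rewrite eqz_nat -lt0n prime_gt0.
    - rewrite rpredM ?rpredX ?rpredN1 // rpredB // !rpredM // ?Aint_int //.
      rewrite /w coef_comp_poly_Xn //; case: ifP => _; last exact: rpred0.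
      by rewrite coef_map Aint_int.
    have := GDk i; rewrite -/w hE cE !rmorphM /= => hh.
    set t := (-1) ^+ s in hh *; have t2 : t * t = 1 by rewrite -expr2 sqrr_sign.
    transitivity (t * (e'%:~R * (t * E%:~R + r%:R * h)) - t * e'%:~R * r%:R * h).
      by rewrite -[LHS]mul1r -t2; ring.
    by rewrite hh -[r%:R]/(r%:~R); ring.
  rewrite prime_dvdzM // (negPf rE) orbF => re; exact: nprime rp co re rl.
have [s es] : exists s : nat, e = (-1) ^+ s * l ^+ n.
  by apply: int_eq_or_opp; rewrite eE lE !abszM e1 l1.
exists g, (odd (n.+1 * size A + s)).
rewrite -/G signr_odd -(rmorph_sign polyC) mul_polyC GE scalerA DE comp_polyZ.
congr (_ *: _); transitivity (eps * eps * ((-1) ^+ s * l%:~R ^+ n)).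
  by rewrite eps2 mul1r es rmorphM !rmorphXn rmorphN1.
by rewrite exprD -/eps; ring.
Qed.

Theorem theorem1p6 (m n : nat) (Delta : {poly int}) :
  (0 < m)%N -> (0 < n)%N -> coprime m n -> primitive_zpoly Delta ->
  (hartley (m * n) Delta <-> (hartley m Delta /\ hartley n Delta)).
Proof.
move=> m0 n0 co Dprim; have N0 : (0 < m * n)%N by rewrite muln_gt0 m0.
have D0 : Delta != 0.
  by apply/eqP => D0; apply: (Dprim 2) => // i; rewrite D0 coef0 dvdz0.
have e0 : ((lead_coef Delta)%:~R : algC) != 0 by rewrite intr_eq0 lead_coef_eq0.
(* The mn-th powers of A are the m-th powers of its n-th powers, and vice versa. *)
split=> [/(hartley_ratseq N0 D0)[A rA DA]|[hm hn]].
  split; [apply: (ratseq_hartley m0 Dprim (ratseq_exp n rA))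
         | apply: (ratseq_hartley n0 Dprim (ratseq_exp m rA))].
    rewrite DA -map_comp; congr (_ *: _); apply: congr_big => //.
    by apply: eq_map => x /=; rewrite -exprM mulnC.
  rewrite DA -map_comp; congr (_ *: _); apply: congr_big => //.
  by apply: eq_map => x /=; rewrite -exprM.
have [A rA DA] := hartley_ratseq m0 D0 hm; have [B rB DB] := hartley_ratseq n0 D0 hn.
set D := [seq x ^+ m | x <- A] in DA.
have BD : perm_eq [seq x ^+ n | x <- B] D.
  by apply: prod_XsubC_eq; apply: (scalerI e0); rewrite -DB.
have rD : ratseq D by apply: ratseq_exp.
(* The coprime [d1] and [d2] both divide the multiplicity of [b], because D consists of the m-th
   powers of A and, up to order, of the n-th powers of B. *)
have [|C rC CD] := ratseq_exp_lift N0 rD.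
  move=> b bD; have [d1 [d2 [cod ind1 ind2 ind]]] := alg_root_index_coprime b m0 n0 co.
  exists (d1 * d2)%N; rewrite ?Gauss_dvd // (alg_root_index_dvd_count m0 rA ind1) /=.
  by rewrite -(permP BD) (alg_root_index_dvd_count n0 rB ind2).
by apply: (ratseq_hartley N0 Dprim rC); rewrite DA (perm_big _ CD).
Qed.
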